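(* Let $R$ be a ring and let $M=(\cdots\to M^{i-1}\to M^i\to M^{i+1}\to\cdots)$ be a complex of left $R$-modules. Then $M$ is Gorenstein projective in $\mathrm{Ch}(R)$ if and only if each $M^i$ is Gorenstein projective in $\mathrm{Mod}(R)$.
   Context: Rings are associative with unit; $R$ is arbitrary. $\mathrm{Mod}(R)$ is the category of left $R$-modules and $\mathrm{Ch}(R)$ is the abelian category of (unbounded) cochain complexes of left $R$-modules with chain maps as morphisms. In an abelian category $\mathcal{C}$ with enough projectives, an object $M$ is Gorenstein projective if there is an acyclic complex $\mathbf{P}=\cdots\to P_1\to P_0\to P_{-1}\to\cdots$ of projective objects of $\mathcal{C}$ such that $\mathrm{Hom}_{\mathcal{C}}(\mathbf{P},P)$ is acyclic for every projective object $P$ of $\mathcal{C}$, with $M=\mathrm{Ker}(P_0\to P_{-1})$. *)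

(* Defs.v *)
From HB Require Import structures.
From mathcomp Require Import all_boot all_algebra.
From mathcomp Require Import boolp.

Set Implicit Arguments.
Unset Strict Implicit.
Unset Printing Implicit Defensive.

Import GRing.Theory.
Local Open Scope ring_scope.

Record preadditive := Preadditive {
  obj :> Type;
  mor : obj -> obj -> zmodType;
  idhom : forall A, mor A A;
  compm : forall A B C, mor B C -> mor A B -> mor A C;
  comp1m : forall A B (f : mor A B), compm (idhom B) f = f;
  compm1 : forall A B (f : mor A B), compm f (idhom A) = f;
  compmA : forall A B C D (h : mor C D) (g : mor B C) (f : mor A B),
    compm h (compm g f) = compm (compm h g) f;
  compmDl : forall A B C (g1 g2 : mor B C) (f : mor A B),
    compm (g1 + g2) f = compm g1 f + compm g2 f;
  compmDr : forall A B C (g : mor B C) (f1 f2 : mor A B),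
    compm g (f1 + f2) = compm g f1 + compm g f2
}.

Arguments mor {p} A B.
Arguments idhom {p} A.
Arguments compm {p A B C} g f.

Section Preadditive.
Variable C : preadditive.

Lemma comp0m (X Y Z : C) (f : mor X Y) : compm (0 : mor Y Z) f = 0.
Proof. by apply: (@addrI _ (compm 0 f)); rewrite -compmDl !addr0. Qed.

Lemma compm0 (X Y Z : C) (g : mor Y Z) : compm g (0 : mor X Y) = 0.
Proof. by apply: (@addrI _ (compm g 0)); rewrite -compmDr !addr0. Qed.

Definition epi (X Y : C) (e : mor X Y) : Prop :=
  forall (Z : C) (g h : mor Y Z), compm g e = compm h e -> g = h.

Definition is_kernel (K X Y : C) (k : mor K X) (f : mor X Y) : Prop :=
  compm f k = 0 /\
  forall (Z : C) (h : mor Z X), compm f h = 0 -> exists! u : mor Z K, compm k u = h.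

Definition projective (P : C) : Prop :=
  forall (X Y : C) (e : mor X Y) (f : mor P Y),
    epi e -> exists g : mor P X, compm e g = f.

(* In an abelian category, the comparison map im f -> ker g is an isomorphism
   iff f factors through ker g by an epimorphism. *)
Definition exact_at (X Y Z : C) (f : mor X Y) (g : mor Y Z) : Prop :=
  exists (K : C) (k : mor K Y) (e : mor X K),
    [/\ is_kernel k g, epi e & f = compm k e].

Record complex := Complex {
  cobj :> int -> C;
  cdiff : forall n : int, mor (cobj n) (cobj (n + 1));
  cdiffK : forall n : int, compm (cdiff (n + 1)) (cdiff n) = 0
}.

Definition acyclic (X : complex) : Prop :=
  forall n : int, exact_at (cdiff X n) (cdiff X (n + 1)).

(* mor(X, Q) is the complex of abelian groups
     ... -> mor(X^(n+2), Q) -> mor(X^(n+1), Q) -> mor(X^n, Q) -> ...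
   whose maps are precomposition with the differentials of X. *)
Definition hom_acyclic (X : complex) (Q : C) : Prop :=
  forall (n : int) (f : mor (X (n + 1)) Q),
    compm f (cdiff X n) = 0 <->
    exists g : mor (X (n + 1 + 1)) Q, f = compm g (cdiff X (n + 1)).

(* Cohomological indexing, P^n = P_(-n), so that Ker (P_0 -> P_(-1)) is the
   kernel of cdiff P 0. *)
Definition gorenstein_projective (M : C) : Prop :=
  exists P : complex,
    [/\ acyclic P,
        forall n : int, projective (P n),
        forall Q : C, projective Q -> hom_acyclic P Q &
        exists k : mor M (P 0), is_kernel k (cdiff P 0)].

Record chain_map (X Y : complex) := ChainMap {
  cmap :> forall n : int, mor (X n) (Y n);
  cmapP : forall n : int,
    compm (cdiff Y n) (cmap n) = compm (cmap (n + 1)) (cdiff X n)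
}.

Lemma chain_map_eq (X Y : complex) (f g : chain_map X Y) :
  (forall n, f n = g n) -> f = g.
Proof.
case: f g => f fP [g gP] /= fg.
have {}fg : f = g by apply: functional_extensionality_dep.
by case: _ / fg gP => gP; rewrite (Prop_irrelevance fP gP).
Qed.

Section ChainMapZmod.
Variables X Y : complex.

HB.instance Definition _ := gen_eqMixin (chain_map X Y).
HB.instance Definition _ := gen_choiceMixin (chain_map X Y).

Fact zero_chain_mapP n :
  compm (cdiff Y n) (0 : mor (X n) (Y n)) = compm 0 (cdiff X n).
Proof. by rewrite comp0m compm0. Qed.
Definition zero_chain_map : chain_map X Y := ChainMap zero_chain_mapP.

Fact add_chain_mapP (f g : chain_map X Y) n :
  compm (cdiff Y n) (f n + g n) = compm (f (n + 1) + g (n + 1)) (cdiff X n).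
Proof. by rewrite compmDl compmDr !cmapP. Qed.
Definition add_chain_map f g : chain_map X Y := ChainMap (add_chain_mapP f g).

Fact opp_chain_mapP (f : chain_map X Y) n :
  compm (cdiff Y n) (- f n) = compm (- f (n + 1)) (cdiff X n).
Proof.
apply: (@addrI _ (compm (cdiff Y n) (f n))).
by rewrite -compmDr subrr compm0 cmapP -compmDl subrr comp0m.
Qed.
Definition opp_chain_map f : chain_map X Y := ChainMap (opp_chain_mapP f).

Fact add_chain_mapA : associative add_chain_map.
Proof. by move=> f g h; apply: chain_map_eq => n; apply: addrA. Qed.
Fact add_chain_mapC : commutative add_chain_map.
Proof. by move=> f g; apply: chain_map_eq => n; apply: addrC. Qed.
Fact add0_chain_map : left_id zero_chain_map add_chain_map.
Proof. by move=> f; apply: chain_map_eq => n; apply: add0r. Qed.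
Fact addN_chain_map : left_inverse zero_chain_map opp_chain_map add_chain_map.
Proof. by move=> f; apply: chain_map_eq => n; apply: addNr. Qed.

HB.instance Definition _ := GRing.isZmodule.Build (chain_map X Y)
  add_chain_mapA add_chain_mapC add0_chain_map addN_chain_map.
End ChainMapZmod.

Fact id_chain_mapP (X : complex) n :
  compm (cdiff X n) (idhom (X n)) = compm (idhom (X (n + 1))) (cdiff X n).
Proof. by rewrite comp1m compm1. Qed.
Definition id_chain_map (X : complex) : chain_map X X :=
  ChainMap (@id_chain_mapP X).

Fact comp_chain_mapP (X Y Z : complex) (g : chain_map Y Z) (f : chain_map X Y) n :
  compm (cdiff Z n) (compm (g n) (f n)) =
  compm (compm (g (n + 1)) (f (n + 1))) (cdiff X n).
Proof. by rewrite compmA cmapP -compmA cmapP compmA. Qed.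
Definition comp_chain_map (X Y Z : complex) (g : chain_map Y Z)
  (f : chain_map X Y) : chain_map X Z := ChainMap (comp_chain_mapP g f).

Fact chain_comp1m (X Y : complex) (f : chain_map X Y) :
  comp_chain_map (id_chain_map Y) f = f.
Proof. by apply: chain_map_eq => n; apply: comp1m. Qed.
Fact chain_compm1 (X Y : complex) (f : chain_map X Y) :
  comp_chain_map f (id_chain_map X) = f.
Proof. by apply: chain_map_eq => n; apply: compm1. Qed.
Fact chain_compA (X Y Z T : complex)
    (h : chain_map Z T) (g : chain_map Y Z) (f : chain_map X Y) :
  comp_chain_map h (comp_chain_map g f) = comp_chain_map (comp_chain_map h g) f.
Proof. by apply: chain_map_eq => n; apply: compmA. Qed.
Fact chain_compDl (X Y Z : complex) (g1 g2 : chain_map Y Z) (f : chain_map X Y) :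
  comp_chain_map (g1 + g2) f = comp_chain_map g1 f + comp_chain_map g2 f.
Proof. by apply: chain_map_eq => n; apply: compmDl. Qed.
Fact chain_compDr (X Y Z : complex) (g : chain_map Y Z) (f1 f2 : chain_map X Y) :
  comp_chain_map g (f1 + f2) = comp_chain_map g f1 + comp_chain_map g f2.
Proof. by apply: chain_map_eq => n; apply: compmDr. Qed.

Definition complexes : preadditive :=
  @Preadditive complex (fun X Y => chain_map X Y : zmodType)
    id_chain_map comp_chain_map
    chain_comp1m chain_compm1 chain_compA chain_compDl chain_compDr.

End Preadditive.

Section ModuleCategory.
Variable R : pzRingType.

(* An alias carrying the additive group structure, so as not to declare
   instances on the library's {linear U -> V} itself. *)
Definition mod_hom (U V : lmodType R) : Type := {linear U -> V}.

Section ModHomZmod.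
Variables U V : lmodType R.

Lemma mod_hom_eq (f g : mod_hom U V) : (forall x : U, f x = g x) -> f = g.
Proof.
destruct f as [f [fD fZ]], g as [g [gD gZ]] => /= fg.
have E : f = g by apply: functional_extensionality_dep.
subst g; congr GRing.Linear.Pack.
destruct fD as [[? ?]], gD as [[? ?]], fZ, gZ.
by f_equal; f_equal; try f_equal; apply: Prop_irrelevance.
Qed.

HB.instance Definition _ := gen_eqMixin (mod_hom U V).
HB.instance Definition _ := gen_choiceMixin (mod_hom U V).

Definition zero_mod_hom : mod_hom U V := \0%R.
Definition add_mod_hom (f g : mod_hom U V) : mod_hom U V := (f \+ g)%R.
Definition opp_mod_hom (f : mod_hom U V) : mod_hom U V := (\- f)%R.

Fact add_mod_homA : associative add_mod_hom.
Proof. by move=> f g h; apply: mod_hom_eq => x; apply: addrA. Qed.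
Fact add_mod_homC : commutative add_mod_hom.
Proof. by move=> f g; apply: mod_hom_eq => x; apply: addrC. Qed.
Fact add0_mod_hom : left_id zero_mod_hom add_mod_hom.
Proof. by move=> f; apply: mod_hom_eq => x; apply: add0r. Qed.
Fact addN_mod_hom : left_inverse zero_mod_hom opp_mod_hom add_mod_hom.
Proof. by move=> f; apply: mod_hom_eq => x; apply: addNr. Qed.

HB.instance Definition _ := GRing.isZmodule.Build (mod_hom U V)
  add_mod_homA add_mod_homC add0_mod_hom addN_mod_hom.
End ModHomZmod.

Definition id_mod_hom (U : lmodType R) : mod_hom U U := idfun.
Definition comp_mod_hom (U V W : lmodType R) (g : mod_hom V W)
  (f : mod_hom U V) : mod_hom U W := g \o f.

Fact mod_comp1m (U V : lmodType R) (f : mod_hom U V) :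
  comp_mod_hom (id_mod_hom V) f = f.
Proof. exact: mod_hom_eq. Qed.
Fact mod_compm1 (U V : lmodType R) (f : mod_hom U V) :
  comp_mod_hom f (id_mod_hom U) = f.
Proof. exact: mod_hom_eq. Qed.
Fact mod_compA (U V W T : lmodType R)
    (h : mod_hom W T) (g : mod_hom V W) (f : mod_hom U V) :
  comp_mod_hom h (comp_mod_hom g f) = comp_mod_hom (comp_mod_hom h g) f.
Proof. exact: mod_hom_eq. Qed.
Fact mod_compDl (U V W : lmodType R) (g1 g2 : mod_hom V W) (f : mod_hom U V) :
  comp_mod_hom (g1 + g2) f = comp_mod_hom g1 f + comp_mod_hom g2 f.
Proof. exact: mod_hom_eq. Qed.
Fact mod_compDr (U V W : lmodType R) (g : mod_hom V W) (f1 f2 : mod_hom U V) :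
  comp_mod_hom g (f1 + f2) = comp_mod_hom g f1 + comp_mod_hom g f2.
Proof. by apply: mod_hom_eq => x; apply: (linearD (g : {linear V -> W})). Qed.

Definition Mod : preadditive :=
  @Preadditive (lmodType R) (fun U V => mod_hom U V : zmodType)
    id_mod_hom comp_mod_hom
    mod_comp1m mod_compm1 mod_compA mod_compDl mod_compDr.

Definition Ch : preadditive := complexes Mod.

End ModuleCategory.

(* Main.v *)
Require Import Defs.
From HB Require Import structures.
From mathcomp Require Import all_boot all_algebra.
From mathcomp Require Import ring boolp.

(** The argument uses only universal properties, so it takes place in an arbitrary
preadditive category C with binary biproducts; modules come in at the end,
through their direct sums.

The first idea is to avoid totally acyclic complexes. Call a short exact
sequence A -> B -> X proj-exact if it stays exact under Hom(-, Q) for every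
projective Q. Cutting a totally acyclic complex into short exact sequences,
and splicing such sequences back, shows that the Gorenstein projective objects
form the largest class in which every X has proj-exact sequences X -> P -> Y
and Z -> P' -> X with P, P' projective and Y, Z again in the class
([gp_biresolving], [biresolving_gp]). An object is thus shown to be Gorenstein
projective by exhibiting a class that contains it and has this property.

The second idea relates a complex to its terms. For a family X of objects, let
[cone X] have X^n (+) X^(n+1) in degree n and differential (a, b) |-> (b, 0).
A chain map from A to [cone X] is a family of maps A^n -> X^n, and one from
[cone X] to A is a family of maps X^(n+1) -> A^n. Hence epimorphisms, kernels
and proj-exact sequences of complexes are the levelwise ones, projective
complexes are levelwise projective, and [cone X] is projective as soon as
every X^n is ([levelwise_proj_exact], [projective_level], [projective_cone]).
The terms of Gorenstein projective complexes therefore form a class as above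
([gp_level]).

Conversely let every M^n be Gorenstein projective. Choose proj-exact sequences
M^n -> P^n -> G^n with G^n Gorenstein projective. The map M -> [cone P] with
components (a, a d) is levelwise the map a : M^n -> P^n paired with a map that
factors through a, because P^(n+1) is projective; a shear of P^n (+) P^(n+1)
then identifies its cokernel with G^n (+) P^(n+1). This sum is Gorenstein
projective ([gp_bip]), so the cokernel complex is again levelwise Gorenstein
projective ([levelwise_gp_right]). The dual construction works on the left
([levelwise_gp_left]), so the levelwise Gorenstein projective complexes form a
class as above. *)

Set Implicit Arguments.
Unset Strict Implicit.
Unset Printing Implicit Defensive.

Import GRing.Theory.
Local Open Scope ring_scope.

Local Notation "g ∘ f" := (compm g f) (at level 40, left associativity).

(** * Families and chains indexed by the integers *)

(** Since [m - 1 + 1] is not convertible to [m], families that are naturally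
given at the successors n + 1 have to be transported to all degrees. *)
Lemma int_shift (T : int -> Type) (f : forall n, T (n + 1)) :
  exists g : forall m, T m, forall n, g (n + 1) = f n.
Proof.
exists (fun m => eq_rect _ T (f (m - 1)) m (subrK 1 m)) => n.
suff E m (e : m + 1 = n + 1) : eq_rect (m + 1) T (f m) (n + 1) e = f n by exact: E.
have mn : m = n by apply: addIr e.
by subst m; rewrite (eq_irrelevance e erefl).
Qed.

Lemma int_pred (Q : int -> Prop) : (forall n, Q (n + 1)) -> forall m, Q m.
Proof. by move=> QS m; rewrite -(subrK 1 m); apply: QS. Qed.

Lemma dep_choice (I : Type) (T : I -> Type) (Q : forall i, T i -> Prop) :
  (forall i, exists x, Q i x) -> exists f : forall i, T i, forall i, Q i (f i).
Proof. by move=> ex; exists (fun i => sval (cid (ex i))) => i; case: cid. Qed.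

(** This splices: with r relating the two ends of an exact sequence, a chain
through x is a two-sided resolution of x. *)
Lemma int_chain (S : Type) (r : S -> S -> Prop) :
  (forall x, exists y, r x y) -> (forall y, exists x, r x y) ->
  forall x, exists z : int -> S, z 0 = x /\ forall n, r (z n) (z (n + 1)).
Proof.
move=> /choice[succ rS] /choice[pred rP] x.
exists (fun n => match n with Posz k => iter k succ x
                            | Negz k => iter k.+1 pred x end).
split=> // -[k|[|k]]; last 2 first.
- exact: rP.
- have -> : Negz k.+1 + 1 = Negz k by rewrite !NegzE; ring.
  exact: rP.
by rewrite -PoszD addn1; apply: rS.
Qed.

(** * Gorenstein projective objects as a largest class *)

Section ProjExact.
Variable C : preadditive.
Implicit Types A B X Y Z P Q : C.

Lemma compmN A B X (g : mor B X) (f : mor A B) : g ∘ (- f) = - (g ∘ f).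
Proof. by apply/eqP; rewrite -addr_eq0 -compmDr addNr compm0. Qed.

Lemma compNm A B X (g : mor B X) (f : mor A B) : (- g) ∘ f = - (g ∘ f).
Proof. by apply/eqP; rewrite -addr_eq0 -compmDl addNr comp0m. Qed.

Lemma kernel_mono A B X (k : mor A B) (f : mor B X) : is_kernel k f ->
  forall Z (u v : mor Z A), k ∘ u = k ∘ v -> u = v.
Proof.
move=> [fk ker] Z u v kuv.
have [|w [_ uniqw]] := ker Z (k ∘ v); first by rewrite compmA fk comp0m.
by rewrite -(uniqw u kuv) -(uniqw v).
Qed.

Lemma kernel_lift A B X (k : mor A B) (f : mor B X) : is_kernel k f ->
  forall Z (h : mor Z B), f ∘ h = 0 -> exists u : mor Z A, k ∘ u = h.
Proof. by move=> [_ ker] Z h /ker[u [ku _]]; exists u. Qed.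

Lemma is_kernelI A B X (k : mor A B) (f : mor B X) :
    f ∘ k = 0 ->
    (forall Z (u v : mor Z A), k ∘ u = k ∘ v -> u = v) ->
    (forall Z (h : mor Z B), f ∘ h = 0 -> exists u : mor Z A, k ∘ u = h) ->
  is_kernel k f.
Proof.
move=> fk inj lift; split=> // Z h /lift[u ku]; exists u; split=> // v kv.
by apply: inj; rewrite ku kv.
Qed.

Lemma kernel_compl A B X Y (k : mor A B) (f : mor B X) (m : mor X Y) :
    (forall Z (u v : mor Z X), m ∘ u = m ∘ v -> u = v) ->
  is_kernel k (m ∘ f) <-> is_kernel k f.
Proof.
move=> inj; have E Z (h : mor Z B) : m ∘ f ∘ h = 0 <-> f ∘ h = 0.
  by rewrite -compmA -(compm0 _ m); split=> [/inj|->].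
by split=> -[fk ker]; split=> [|Z h fh]; try apply/E => //; apply/ker/E.
Qed.

(** Exactness of Hom(X, Q) -> Hom(B, Q) -> Hom(A, Q) -> 0. When [e] is epi the
first map is injective, so in [proj_exact] the sequence is short exact. *)
Definition hom_exact Q A B X (k : mor A B) (e : mor B X) : Prop :=
  (forall f : mor A Q, exists g : mor B Q, g ∘ k = f) /\
  (forall f : mor B Q, f ∘ k = 0 -> exists g : mor X Q, g ∘ e = f).

Definition proj_exact A B X (k : mor A B) (e : mor B X) : Prop :=
  [/\ is_kernel k e, epi e & forall Q, projective Q -> hom_exact Q k e].

(** Hom(-, Q) is a retract of Hom(-, Q'), and a retract of an exact sequence is
exact. This reduces projective complexes to cones. *)
Lemma hom_exact_retract Q Q' A B X (k : mor A B) (e : mor B X)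
    (r : mor Q' Q) (s : mor Q Q') :
  r ∘ s = idhom Q -> hom_exact Q' k e -> hom_exact Q k e.
Proof.
move=> rs [ext fac]; split=> f.
  have [g gk] := ext (s ∘ f); exists (r ∘ g).
  by rewrite -compmA gk compmA rs comp1m.
move=> fk; have [|g ge] := fac (s ∘ f); first by rewrite -compmA fk compm0.
by exists (r ∘ g); rewrite -compmA ge compmA rs comp1m.
Qed.

Definition proj_ext A X : Prop :=
  exists P (k : mor A P) (e : mor P X), projective P /\ proj_exact k e.

Definition biresolving (G : C -> Prop) : Prop := forall X, G X ->
  (exists2 Y, G Y & proj_ext X Y) /\ (exists2 Y, G Y & proj_ext Y X).

(** Splicing the sequences Z^n -> P^n -> Z^(n+1) of a two-sided chain through X
gives a complex P with cycles Z^n. A map P^(n+1) -> Q that kills the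
boundaries factors through Z^(n+2) and then extends to P^(n+2), by
Hom-exactness of two successive sequences. *)
Lemma biresolving_gp (G : C -> Prop) : biresolving G ->
  forall X, G X -> gorenstein_projective X.
Proof.
move=> resG X GX.
pose r (A B : {X | G X}) := proj_ext (sval A) (sval B).
have [||z [z0 rz]] := @int_chain {X | G X} r _ _ (exist _ X GX).
- by case=> Y GY; have [[Y' GY' ?] _] := resG Y GY; exists (exist _ Y' GY').
- by case=> Y GY; have [_ [Y' GY' ?]] := resG Y GY; exists (exist _ Y' GY').
pose Zn n := sval (z n).
have [P /dep_choice[k /dep_choice[e ke]]] :=
  dep_choice (rz : forall n, proj_ext (Zn n) (Zn (n + 1))).
have <- : Zn 0 = X by rewrite /Zn z0.
have kK n : is_kernel (k n) (e n) by case: (ke n) => _ [].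
have eE n : epi (e n) by case: (ke n) => _ [].
have ek n : e n ∘ k n = 0 by case: (kK n).
have dK n : is_kernel (k n) (k (n + 1) ∘ e n).
  exact/(kernel_compl _ _ (kernel_mono (kK (n + 1)))).
have dd n : (k (n + 1 + 1) ∘ e (n + 1)) ∘ (k (n + 1) ∘ e n) = 0.
  by rewrite compmA -(compmA _ (e (n + 1))) ek compm0 comp0m.
exists (Complex dd); split=> /=.
- by move=> n; exists (Zn (n + 1)), (k (n + 1)), (e n); split.
- by move=> n; case: (ke n).
- move=> Q projQ n f; split=> /= [fd|[g ->]]; last by rewrite -compmA dd compm0.
  have [_ [_ _ /(_ _ projQ)[_ fac]]] := ke (n + 1).
  have [|h he] := fac f; first by apply: (eE n); rewrite comp0m -compmA.
  have [_ [_ _ /(_ _ projQ)[ext _]]] := ke (n + 1 + 1).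
  by have [g gk] := ext h; exists g; rewrite compmA gk he.
- by exists (k 0); apply: dK.
Qed.

(** Cycles in any degree are allowed, not only in degree 0: this makes the class
closed under passing to the neighbouring cycles without reindexing complexes. *)
Definition syzygy X : Prop := exists (P : complex C) (n : int),
  [/\ acyclic P, forall n : int, projective (P n),
      forall Q, projective Q -> hom_acyclic P Q &
      exists k : mor X (P n), is_kernel k (cdiff P n)].

(** Exactness provides some kernel for which this holds; any two kernels of a map
are isomorphic. *)
Lemma acyclic_onto_cycles (P : complex C) n X (k : mor X (P (n + 1))) :
    acyclic P -> is_kernel k (cdiff P (n + 1)) ->
  exists2 p : mor (P n) X, epi p & cdiff P n = k ∘ p.
Proof.
move=> /(_ n)[Z [j [p [jK pE dE]]]] kK.
have [j' jj'] := kernel_lift kK jK.1; have [k' kk'] := kernel_lift jK kK.1.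
exists (j' ∘ p); last by rewrite compmA jj'.
have j'k' : j' ∘ k' = idhom X.
  by apply: (kernel_mono kK); rewrite compmA jj' kk' compm1.
move=> A f g; rewrite !compmA => /pE fg.
by rewrite -(compm1 f) -(compm1 g) -j'k' !compmA fg.
Qed.

Lemma syzygy_biresolving : biresolving syzygy.
Proof.
move=> X [P [n [exP projP homP [k kK]]]].
have step m Y Z (i : mor Y (P m)) (j : mor Z (P (m + 1))) :
    is_kernel i (cdiff P m) -> is_kernel j (cdiff P (m + 1)) -> proj_ext Y Z.
  (* m is replaced by m + 2, since a map Y -> Q is extended after pulling it
     back to P^(m+1), which maps onto Y and has a term before it *)
  elim/int_pred: m => m in i j *; elim/int_pred: m => m in i j *.
  move=> iK jK; have [q qE dE] := acyclic_onto_cycles exP iK.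
  have [p pE dE'] := acyclic_onto_cycles exP jK.
  exists (P (m + 1 + 1)), i, p; split=> //; have jm := kernel_mono jK.
  have ipK : is_kernel i p by move: iK; rewrite dE' => /(kernel_compl _ _ jm).
  split=> // Q projQ; have hom := homP Q projQ.
  split=> f.
    have [|g fg] := (hom m (f ∘ q)).1.
      have qd : q ∘ cdiff P m = 0.
        by apply: (kernel_mono iK); rewrite compmA -dE cdiffK compm0.
      by rewrite -compmA qd compm0.
    by exists g; apply: qE; rewrite fg dE compmA.
  move=> fi; have [|g fg] := (hom _ f).1; first by rewrite dE compmA fi comp0m.
  by exists (g ∘ j); rewrite fg dE' compmA.
split.
  have [Z [j [p [jK _ _]]]] := exP n.
  exists Z; first by exists P, (n + 1); split=> //; exists j.
  exact: step kK jK.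
elim/int_pred: n => n in k kK *; elim/int_pred: n => n in k kK *.
have [Y [i [_ [iK _ _]]]] := exP n.
exists Y; first by exists P, (n + 1); split=> //; exists i.
exact: step iK kK.
Qed.

Lemma gp_biresolving : biresolving (@gorenstein_projective C).
Proof.
move=> X [P [exP projP homP kK]].
have [|[Y sY XY] [Z sZ ZX]] := syzygy_biresolving (X := X); first by exists P, 0.
by split; [exists Y | exists Z] => //; apply: (biresolving_gp syzygy_biresolving).
Qed.

(** In a proj-exact sequence [e] is a cokernel of [k] as far as projective targets
are concerned; this extends to a Gorenstein projective target G because G
embeds, as a kernel, in a projective object. *)
Lemma proj_exact_factor A B X G (k : mor A B) (e : mor B X) (f : mor B G) :
    proj_exact k e -> gorenstein_projective G -> f ∘ k = 0 ->
  exists g : mor X G, g ∘ e = f.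
Proof.
move=> [_ eE ex] /gp_biresolving[[Y _ [P [i [p [projP [iK _ _]]]]]] _] fk.
have [_ fac] := ex _ projP.
have [|h he] := fac (i ∘ f); first by rewrite -compmA fk compm0.
have [|g ig] := kernel_lift iK (h := h).
  by apply: eE; rewrite -compmA he compmA iK.1 !comp0m.
by exists g; apply: (kernel_mono iK); rewrite compmA ig he.
Qed.
End ProjExact.

(** * Biproducts *)

Record biproducts (C : preadditive) := Biproducts {
  bip :> C -> C -> C;
  in1 : forall A B, mor A (bip A B);
  in2 : forall A B, mor B (bip A B);
  pr1 : forall A B, mor (bip A B) A;
  pr2 : forall A B, mor (bip A B) B;
  pr1_in1 : forall A B, pr1 A B ∘ in1 A B = idhom A;
  pr2_in2 : forall A B, pr2 A B ∘ in2 A B = idhom B;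
  pr1_in2 : forall A B, pr1 A B ∘ in2 A B = 0;
  pr2_in1 : forall A B, pr2 A B ∘ in1 A B = 0;
  bip_id : forall A B,
    in1 A B ∘ pr1 A B + in2 A B ∘ pr2 A B = idhom (bip A B)
}.
Arguments in1 {C} b {A B}.
Arguments in2 {C} b {A B}.
Arguments pr1 {C} b {A B}.
Arguments pr2 {C} b {A B}.

Section Biproduct.
Variables (C : preadditive) (S : biproducts C).
Implicit Types A B X Y Z P Q : C.

Definition bpair A B Z (f : mor Z A) (g : mor Z B) : mor Z (S A B) :=
  in1 S ∘ f + in2 S ∘ g.
Definition copair A B Z (f : mor A Z) (g : mor B Z) : mor (S A B) Z :=
  f ∘ pr1 S + g ∘ pr2 S.

Lemma pr1_pair A B Z (f : mor Z A) (g : mor Z B) : pr1 S ∘ bpair f g = f.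
Proof. by rewrite compmDr !compmA pr1_in1 pr1_in2 comp1m comp0m addr0. Qed.
Lemma pr2_pair A B Z (f : mor Z A) (g : mor Z B) : pr2 S ∘ bpair f g = g.
Proof. by rewrite compmDr !compmA pr2_in1 pr2_in2 comp1m comp0m add0r. Qed.
Lemma copair_in1 A B Z (f : mor A Z) (g : mor B Z) : copair f g ∘ in1 S = f.
Proof. by rewrite compmDl -!compmA pr1_in1 pr2_in1 compm1 compm0 addr0. Qed.
Lemma copair_in2 A B Z (f : mor A Z) (g : mor B Z) : copair f g ∘ in2 S = g.
Proof. by rewrite compmDl -!compmA pr1_in2 pr2_in2 compm1 compm0 add0r. Qed.

Lemma comp_copair A B Y Z (h : mor Z Y) (f : mor A Z) (g : mor B Z) :
  h ∘ copair f g = copair (h ∘ f) (h ∘ g).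
Proof. by rewrite compmDr !compmA. Qed.
Lemma comp_pair A B Y Z (f : mor Z A) (g : mor Z B) (h : mor Y Z) :
  bpair f g ∘ h = bpair (f ∘ h) (g ∘ h).
Proof. by rewrite compmDl -!compmA. Qed.
Lemma copair_pair A B Y Z (f : mor A Z) (g : mor B Z) (h : mor Y A) (k : mor Y B) :
  copair f g ∘ bpair h k = f ∘ h + g ∘ k.
Proof. by rewrite compmDl -!compmA pr1_pair pr2_pair. Qed.

Lemma pair_eta A B Z (f : mor Z (S A B)) : bpair (pr1 S ∘ f) (pr2 S ∘ f) = f.
Proof. by rewrite /bpair !compmA -compmDl bip_id comp1m. Qed.
Lemma copair_eta A B Z (f : mor (S A B) Z) : copair (f ∘ in1 S) (f ∘ in2 S) = f.
Proof. by rewrite /copair -!compmA -compmDr bip_id compm1. Qed.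

Lemma pair_ext A B Z (f g : mor Z (S A B)) :
  pr1 S ∘ f = pr1 S ∘ g -> pr2 S ∘ f = pr2 S ∘ g -> f = g.
Proof. by move=> e1 e2; rewrite -(pair_eta f) e1 e2 pair_eta. Qed.
Lemma copair_ext A B Z (f g : mor (S A B) Z) :
  f ∘ in1 S = g ∘ in1 S -> f ∘ in2 S = g ∘ in2 S -> f = g.
Proof. by move=> e1 e2; rewrite -(copair_eta f) e1 e2 copair_eta. Qed.

Lemma copair_epir A B Z (u : mor A Z) (v : mor B Z) : epi v -> epi (copair u v).
Proof.
move=> vE Y f g; rewrite !comp_copair => /(congr1 (fun h => h ∘ in2 S)).
by rewrite !copair_in2 => /vE.
Qed.

Lemma projective_bip P Q : projective P -> projective Q -> projective (S P Q).
Proof.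
move=> projP projQ X Y e f eE.
have [g eg] := projP _ _ e (f ∘ in1 S) eE.
have [h eh] := projQ _ _ e (f ∘ in2 S) eE.
by exists (copair g h); rewrite comp_copair eg eh copair_eta.
Qed.

(** The case s = 0 is the direct sum of the given sequence with 0 -> Y = Y; the
general case is its image under the shear (b, y) |-> (b, y + s b) of B (+) Y.
The shear is what allows a prescribed second component [s ∘ k] on A. *)
Lemma proj_exact_padr A B X Y (k : mor A B) (e : mor B X) (s : mor B Y) :
  proj_exact k e ->
  proj_exact (bpair k (s ∘ k)) (bpair (e ∘ pr1 S) (pr2 S - s ∘ pr1 S)).
Proof.
move=> [kK eE ex]; split.
- apply: is_kernelI => [|Z u v kuv|Z h].
  + by rewrite comp_pair compmDl compNm -!compmA pr1_pair pr2_pair subrr kK.1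
      /bpair !compm0 addr0.
  + apply: (kernel_mono kK).
    by have := congr1 (fun h => pr1 S ∘ h) kuv; rewrite !compmA pr1_pair.
  + rewrite comp_pair compmDl compNm => h0.
    have h1 : e ∘ pr1 S ∘ h = 0.
      by have := congr1 (fun w => pr1 S ∘ w) h0; rewrite pr1_pair compm0.
    have h2 : pr2 S ∘ h - s ∘ pr1 S ∘ h = 0.
      by have := congr1 (fun w => pr2 S ∘ w) h0; rewrite pr2_pair compm0.
    have [|u ku] := kernel_lift kK (h := pr1 S ∘ h); first by rewrite compmA.
    exists u; rewrite comp_pair -compmA ku compmA; apply: pair_ext.
      by rewrite pr1_pair.
    by rewrite pr2_pair; apply/esym/eqP; rewrite -subr_eq0 h2.
- move=> Z f g fg; apply: copair_ext.
    apply: eE; have := congr1 (fun h => h ∘ bpair (idhom B) s) fg.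
    rewrite -!compmA comp_pair -compmA pr1_pair compm1 compmDl compNm -compmA.
    by rewrite pr2_pair pr1_pair compm1 subrr /bpair compm0 addr0.
  have := congr1 (fun h => h ∘ in2 S) fg.
  rewrite -!compmA comp_pair -compmA pr1_in2 compm0 compmDl compNm -compmA.
  by rewrite pr2_in2 pr1_in2 compm0 subr0 /bpair compm0 add0r compm1.
- move=> Q /ex[ext fac]; split=> f.
    have [g gk] := ext f.
    by exists (g ∘ pr1 S); rewrite -compmA pr1_pair.
  rewrite -(copair_eta f) copair_pair compmA -compmDl => /fac[h he].
  exists (copair h (f ∘ in2 S)).
  rewrite copair_pair compmA he compmDr compmN /copair.
  by rewrite compmA compmDl addrCA addrK addrC.
Qed.

(** Dual to [proj_exact_padr]: a shear of the direct sum of the given sequence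
with Y = Y -> 0, which allows a prescribed component [e ∘ s] on Y. *)
Lemma proj_exact_padl A B X Y (k : mor A B) (e : mor B X) (s : mor Y B) :
  proj_exact k e ->
  proj_exact (bpair (pr2 S) (k ∘ pr1 S - s ∘ pr2 S) : mor (S A Y) _)
             (copair (e ∘ s) e).
Proof.
move=> [kK eE ex]; split.
- apply: is_kernelI => [|Z u v kuv|Z h].
  + rewrite copair_pair compmDr compmN !compmA kK.1 comp0m sub0r.
    by rewrite subrr.
  + have uv2 : pr2 S ∘ u = pr2 S ∘ v.
      by have := congr1 (fun h => pr1 S ∘ h) kuv; rewrite !compmA pr1_pair.
    apply: pair_ext (uv2); apply: (kernel_mono kK).
    have := congr1 (fun h => pr2 S ∘ h) kuv.
    rewrite !compmA pr2_pair !compmDl !compNm -![s ∘ _ ∘ _]compmA uv2.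
    by rewrite -!compmA => /addIr.
  + rewrite -{1}(pair_eta h) copair_pair -compmA -compmDr => /(kernel_lift kK)[u ku].
    exists (bpair u (pr1 S ∘ h)).
    rewrite comp_pair pr2_pair compmDl compNm -!compmA pr1_pair pr2_pair ku.
    by rewrite addrC addKr pair_eta.
- exact: copair_epir.
- move=> Q /ex[ext fac]; split=> f.
    have [h hk] := ext (f ∘ in1 S).
    exists (copair (f ∘ in2 S + h ∘ s) h).
    rewrite copair_pair compmDr compmN compmDl !compmA hk addrCA addrK.
    exact: copair_eta.
  set kk := bpair _ _ => fkk.
  have kk1 : kk ∘ in1 S = in2 S ∘ k.
    rewrite comp_pair compmDl compNm -!compmA pr1_in1 pr2_in1 compm1 !compm0.
    by rewrite subr0 /bpair compm0 add0r.
  have kk2 : kk ∘ in2 S = in1 S - in2 S ∘ s.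
    rewrite comp_pair compmDl compNm -!compmA pr1_in2 pr2_in2 compm1 !compm0.
    by rewrite sub0r /bpair compm1 compmN.
  have [|h he] := fac (f ∘ in2 S); first by rewrite -compmA -kk1 compmA fkk comp0m.
  exists h; rewrite comp_copair compmA he -[RHS]copair_eta; congr copair.
  apply/esym/eqP; rewrite -subr_eq0 -compmA -compmN -compmDr -kk2 compmA fkk.
  by rewrite comp0m.
Qed.

Lemma proj_exact_padr0 A B X Y (k : mor A B) (e : mor B X) :
  proj_exact k e ->
  proj_exact (in1 S ∘ k) (bpair (e ∘ pr1 S) (pr2 S) : mor (S B Y) _).
Proof.
move=> /(@proj_exact_padr _ _ _ Y _ _ 0).
by rewrite /bpair !comp0m compm0 addr0 subr0.
Qed.

Lemma proj_exact_padl0 A B X Y (k : mor A B) (e : mor B X) :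
  proj_exact k e ->
  proj_exact (bpair (pr2 S) (k ∘ pr1 S) : mor (S A Y) _) (e ∘ pr2 S).
Proof.
move=> /(@proj_exact_padl _ _ _ Y _ _ 0).
by rewrite /copair compm0 !comp0m add0r subr0.
Qed.

(** The objects that are Gorenstein projective or of the form G (+) P form a
biresolving class: adding P to the sequences of G leaves their other ends
unchanged. *)
Lemma gp_bip G P : gorenstein_projective G -> projective P ->
  gorenstein_projective (S G P).
Proof.
move=> gpG projP.
pose cls X := gorenstein_projective X \/
  exists2 G, gorenstein_projective G & X = S G P.
apply: (@biresolving_gp _ cls); last by right; exists G.
move=> X [|{G gpG}[G + ->]] => /gp_biresolving[[Y gpY XY] [Z gpZ ZX]].
  by split; [exists Y | exists Z] => //; left.
move: XY ZX => [Q [k [e [projQ ke]]]] [Q' [k' [e' [projQ' ke']]]].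
split; [exists Y | exists Z]; try by left.
  by do 3!eexists; split; last exact: proj_exact_padl0 ke; apply: projective_bip.
by do 3!eexists; split; last exact: proj_exact_padr0 ke'; apply: projective_bip.
Qed.
End Biproduct.

(** * Complexes and their terms *)

Section Complexes.
Variables (C : preadditive) (S : biproducts C).
Implicit Types (A B M N : complex C) (Z Q : C) (X : int -> C).
Local Notation Ch := (complexes C).

Section Cone.
Variable X : int -> C.

Fact cone_diffK n :
  (in1 S ∘ pr2 S : mor (S (X (n + 1)) (X (n + 1 + 1))) (S _ (X (n + 1 + 1 + 1))))
    ∘ (in1 S ∘ pr2 S : mor (S (X n) (X (n + 1))) (S _ (X (n + 1 + 1)))) = 0.
Proof. by rewrite -compmA (compmA (pr2 S)) pr2_in1 comp0m compm0. Qed.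

(** The cone of the identity of X, seen as a complex with zero differential, up
to the order of the summands; equivalently the sum of the disks X^n = X^n in
degrees n - 1 and n. *)
Definition cone : complex C :=
  @Complex C (fun n => S (X n) (X (n + 1))) (fun n => in1 S ∘ pr2 S) cone_diffK.

Lemma cone_diff n : cdiff cone n = in1 S ∘ pr2 S.
Proof. by []. Qed.

Fact to_coneP A (a : forall n, mor (A n) (X n)) n :
  cdiff cone n ∘ bpair S (a n) (a (n + 1) ∘ cdiff A n) =
  bpair S (a (n + 1)) (a (n + 1 + 1) ∘ cdiff A (n + 1)) ∘ cdiff A n.
Proof.
rewrite comp_pair -[_ ∘ _ ∘ cdiff A n]compmA cdiffK compm0 /= -compmA pr2_pair.
by rewrite /bpair compm0 addr0.
Qed.
Definition to_cone A (a : forall n, mor (A n) (X n)) : chain_map A cone :=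
  ChainMap (to_coneP a).

(** The differential of the cone forces the second component in degree n to be the
first component in degree n + 1 composed with that of A. *)
Lemma to_cone_ext A (f g : chain_map A cone) :
  (forall n, pr1 S ∘ f n = pr1 S ∘ g n) -> f = g.
Proof.
move=> fg; apply: chain_map_eq => n; apply: (pair_ext (fg n)).
have pr2E (h : chain_map A cone) : pr2 S ∘ h n = pr1 S ∘ h (n + 1) ∘ cdiff A n.
  by rewrite -compmA -(cmapP h) cone_diff !compmA pr1_in1 comp1m.
by rewrite !pr2E fg.
Qed.

(** On the summand X^(n+1) of degree n + 1, a chain map is forced to be the
differential after its value on the summand X^(n+1) of degree n. The
components u on the first summands are therefore the maps d v, shifted by one
degree. *)
Lemma from_cone A (v : forall n, mor (X (n + 1)) (A n)) :
  exists (u : forall n, mor (X n) (A n)) (f : chain_map cone A),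
    forall n, f n = copair S (u n) (v n).
Proof.
have [u uv] :=
  int_shift (T := fun n => mor (X n) (A n)) (fun n => cdiff A n ∘ v n).
have du : forall n, cdiff A n ∘ u n = 0.
  by apply: int_pred => n; rewrite uv compmA cdiffK comp0m.
exists u.
unshelve eexists (@ChainMap _ cone A (fun n => copair S (u n) (v n)) _) => // n.
rewrite cone_diff comp_copair compmA copair_in1 uv du.
by rewrite /copair comp0m add0r.
Qed.

Lemma from_cone_ext A (f g : chain_map cone A) :
  (forall n, f n ∘ in2 S = g n ∘ in2 S) -> f = g.
Proof.
move=> fg; apply: chain_map_eq; apply: int_pred => n; apply: copair_ext (fg _).
have in1E (h : chain_map cone A) :
    h (n + 1) ∘ in1 S = cdiff A n ∘ (h n ∘ in2 S).
  by rewrite compmA (cmapP h) cone_diff -!compmA pr2_in2 compm1.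
by rewrite !in1E fg.
Qed.

End Cone.

Lemma chain_compE A B D (g : chain_map B D) (f : chain_map A B) n :
  (@compm Ch A B D g f : chain_map A D) n = g n ∘ f n.
Proof. by []. Qed.

(** With a constant family, a cone is a sum of disks on Z in all degrees;
extending a map by zero tests a complex in a single degree. *)
Lemma to_disk A n Z (g : mor (A n) Z) :
  exists f : chain_map A (cone (fun=> Z)),
    pr1 S ∘ f n = g /\ forall m, n != m -> pr1 S ∘ f m = 0.
Proof.
pose a := dfwith (fun m => 0 : mor (A m) Z) g.
exists (to_cone (X := fun=> Z) a); split=> [|m nm]; rewrite pr1_pair /a.
  by rewrite dfwith_in.
by rewrite dfwith_out.
Qed.

Lemma from_disk A n Z (g : mor Z (A n)) :
  exists f : chain_map (cone (fun=> Z)) A,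
    f n ∘ in2 S = g /\ forall m, n != m -> f m ∘ in2 S = 0.
Proof.
have [u [f fE]] :=
  from_cone (X := fun=> Z) (dfwith (fun m => 0 : mor Z (A m)) g).
exists f; split=> [|m nm]; rewrite fE copair_in2.
  by rewrite dfwith_in.
by rewrite dfwith_out.
Qed.

Lemma levelwise_epi A B (e : chain_map A B) :
  @epi Ch A B e <-> forall n, epi (e n).
Proof.
split=> [eE n Z g h ge|eE D g h gh]; last first.
  apply: chain_map_eq => n; apply: eE.
  exact: (congr1 (fun h : chain_map A D => h n) gh).
have [[g' [gn g0]] [h' [hn h0]]] := (to_disk g, to_disk h).
suff E : g' = h' by rewrite -gn -hn E.
apply: eE; apply: to_cone_ext => m; rewrite !chain_compE !compmA.
by have [<-|nm] := eqVneq n m; rewrite ?gn ?hn // g0 // h0.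
Qed.

Lemma levelwise_mono A B (k : chain_map A B) :
    (forall D (u v : chain_map D A),
      @compm Ch D A B k u = @compm Ch D A B k v -> u = v) ->
  forall n Z (u v : mor Z (A n)), k n ∘ u = k n ∘ v -> u = v.
Proof.
move=> kM n Z u v kuv.
have [[u' [un u0]] [v' [vn v0]]] := (from_disk u, from_disk v).
suff E : u' = v' by rewrite -un -vn E.
apply: kM; apply: from_cone_ext => m; rewrite !chain_compE -!compmA.
by have [<-|nm] := eqVneq n m; rewrite ?un ?vn // u0 // v0.
Qed.

(** Testing against maps out of disks gives the kernel in each degree; conversely
levelwise lifts commute with the differentials because kernels are mono. *)
Lemma levelwise_kernel A B D (k : chain_map A B) (e : chain_map B D) :
  @is_kernel Ch A B D k e <-> forall n, is_kernel (k n) (e n).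
Proof.
split=> [kK n|kK].
  apply: is_kernelI.
  - exact: (congr1 (fun f : chain_map A D => f n) kK.1).
  - exact/levelwise_mono/(kernel_mono kK).
  move=> Z h eh.
  have [f [fn f0]] := from_disk h.
  have [|u ku] := kernel_lift kK (h := f).
    apply: from_cone_ext => m; rewrite chain_compE -compmA comp0m.
    by have [<-|/f0->] := eqVneq n m; rewrite ?fn // compm0.
  by exists (u n ∘ in2 S); rewrite compmA -chain_compE ku fn.
apply: is_kernelI.
- by apply: chain_map_eq => n; apply: (kK n).1.
- move=> E u v kuv; apply: chain_map_eq => n; apply: (kernel_mono (kK n)).
  exact: (congr1 (fun f : chain_map E B => f n) kuv).
move=> E h eh.
have /dep_choice[u ku] n : exists u : mor (E n) (A n), k n ∘ u = h n.
  apply: (kernel_lift (kK n)).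
  exact: (congr1 (fun f : chain_map E D => f n) eh).
unshelve eexists (@ChainMap _ E A u _); last exact: chain_map_eq.
move=> n; apply: (kernel_mono (kK (n + 1))).
by rewrite !compmA -cmapP -compmA !ku cmapP.
Qed.

Lemma projective_cone (X : int -> C) :
  (forall n, projective (X n)) -> @projective Ch (cone X).
Proof.
move=> projX A B e f /levelwise_epi eE.
have /dep_choice[v ev] n :
    exists v : mor (X (n + 1)) (A n), e n ∘ v = f n ∘ in2 S.
  exact: projX.
have [u [g gE]] := from_cone v.
exists g; apply: from_cone_ext => n.
by rewrite chain_compE -compmA gE copair_in2 ev.
Qed.

(** Evaluation in degree n has the exact right adjoint Z |-> disk on Z, so it
preserves projectives. *)
Lemma projective_level (Q : complex C) :
  @projective Ch Q -> forall n, projective (Q n).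
Proof.
move=> projQ n A B e f eE.
pose e' := to_cone (A := cone (fun=> A)) (X := fun=> B) (fun m => e ∘ pr1 S).
have e'epi : @epi Ch _ _ e'.
  apply/levelwise_epi => m Z g h.
  have e'1 : e' m ∘ in1 S = in1 S ∘ e.
    rewrite comp_pair cone_diff -!compmA pr2_in1 !compm0.
    by rewrite pr1_in1 compm1 /bpair compm0 addr0.
  have e'2 : e' m ∘ in2 S = in2 S ∘ e.
    rewrite comp_pair cone_diff -!compmA pr2_in2 pr1_in2 compm0 !compm1 pr1_in1.
    by rewrite compm1 /bpair compm0 add0r.
  move=> gh; apply: copair_ext; apply: eE; rewrite -!compmA -?e'1 -?e'2 !compmA gh //.
have [F [Fn _]] := to_disk f.
have [G eG] := projQ _ _ e' F e'epi.
by exists (pr1 S ∘ G n); rewrite -Fn -eG chain_compE !compmA pr1_pair.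
Qed.

(** With X^(n+1) = Q^n, the map [cone X] -> Q that is the identity on the second
summands is epi, so it splits. *)
Lemma retract_cone (Q : complex C) : @projective Ch Q ->
  exists2 X : int -> C, (forall n, projective (X n)) &
  exists (r : chain_map (cone X) Q) (s : chain_map Q (cone X)),
    @compm Ch _ _ _ r s = idhom (Q : Ch).
Proof.
move=> projQ; have [X XQ] := int_shift (T := fun=> obj C) (fun n => Q n).
have /dep_choice[v vE] n : exists v : mor (X (n + 1)) (Q n), epi v.
  by rewrite XQ; exists (idhom (Q n)) => Z g h; rewrite !compm1.
exists X; first by apply: int_pred => n; rewrite XQ; apply: projective_level.
have [u [r rE]] := from_cone v; exists r.
have [|s rs] := projQ _ _ r (idhom (Q : Ch)); last by exists s.
by apply/levelwise_epi => n; rewrite rE; apply: copair_epir.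
Qed.

Lemma hom_exact_cone A B D (k : chain_map A B) (e : chain_map B D) (X : int -> C) :
  (forall n, hom_exact (X n) (k n) (e n)) -> @hom_exact Ch (cone X) A B D k e.
Proof.
move=> ex; split=> f.
  have /dep_choice[g gk] n : exists g : mor (B n) (X n), g ∘ k n = pr1 S ∘ f n.
    exact: (ex n).1.
  exists (to_cone g); apply: to_cone_ext => n.
  by rewrite chain_compE compmA pr1_pair gk.
move=> fk.
have /dep_choice[g ge] n : exists g : mor (D n) (X n), g ∘ e n = pr1 S ∘ f n.
  by apply: (ex n).2; rewrite -compmA -(chain_compE f k) fk compm0.
exists (to_cone g); apply: to_cone_ext => n.
by rewrite chain_compE compmA pr1_pair ge.
Qed.

Lemma levelwise_hom_exact A B D (k : chain_map A B) (e : chain_map B D) Q :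
  @hom_exact Ch (cone (fun=> Q)) A B D k e -> forall n, hom_exact Q (k n) (e n).
Proof.
move=> [ext fac] n; split=> f.
  have [F [Fn _]] := to_disk f; have [G GF] := ext F.
  by exists (pr1 S ∘ G n); rewrite -Fn -GF chain_compE compmA.
move=> fk; have [F [Fn F0]] := to_disk f; have [|G GF] := fac F.
  apply: to_cone_ext => m; rewrite chain_compE compmA compm0.
  by have [<-|/F0->] := eqVneq n m; rewrite ?Fn // comp0m.
by exists (pr1 S ∘ G n); rewrite -Fn -GF chain_compE compmA.
Qed.

(** Projective complexes are retracts of cones of projectives, and Hom into [cone
X] is the product over n of Hom(-, X^n) in degree n; so Hom-exactness is
levelwise too. *)
Lemma levelwise_proj_exact A B D (k : chain_map A B) (e : chain_map B D) :
  @proj_exact Ch A B D k e <-> forall n, proj_exact (k n) (e n).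
Proof.
split=> [[/levelwise_kernel kK /levelwise_epi eE ex] n|ke].
  split=> // Q projQ; apply: levelwise_hom_exact.
  by apply: ex; apply: projective_cone.
split.
- by apply/levelwise_kernel => n; case: (ke n).
- by apply/levelwise_epi => n; case: (ke n).
move=> Q /retract_cone[X projX [r [s rs]]].
apply: (hom_exact_retract rs); apply: hom_exact_cone => n.
by case: (ke n) => _ _; apply.
Qed.

(** Evaluating at i the sequences that resolve a Gorenstein projective complex
shows that the i-th terms of such complexes form a biresolving class. *)
Lemma gp_level M :
  @gorenstein_projective Ch M -> forall i, gorenstein_projective (M i).
Proof.
have level A B : @proj_ext Ch A B -> forall i, proj_ext (A i) (B i).
  move=> [P [k [e [projP ke]]]] i.
  exists (P i), ((k : chain_map A P) i), ((e : chain_map P B) i).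
  by split; [apply: projective_level | apply: (levelwise_proj_exact k e).1].
move=> gpM i; pose cls Z := exists2 N, @gorenstein_projective Ch N & Z = N i.
apply: (@biresolving_gp _ cls); last by exists M.
move=> _ [N /gp_biresolving[[A gpA NA] [B gpB BN]] ->].
by split; [exists (A i); [exists A | apply: level]
          | exists (B i); [exists B | apply: level]].
Qed.

Lemma kernel_complex A B (K : int -> C) (e : chain_map A B)
    (k : forall n, mor (K n) (A n)) : (forall n, is_kernel (k n) (e n)) ->
  exists d dd, exists k' : chain_map (@Complex C K d dd) A, forall n, k' n = k n.
Proof.
move=> kK.
have /dep_choice[d kd] n :
    exists d : mor (K n) (K (n + 1)), k (n + 1) ∘ d = cdiff A n ∘ k n.
  by apply: (kernel_lift (kK _)); rewrite compmA -cmapP -compmA (kK n).1 compm0.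
have dd n : d (n + 1) ∘ d n = 0.
  apply: (kernel_mono (kK _)).
  by rewrite compmA kd -compmA kd compmA cdiffK comp0m compm0.
exists d, dd.
by unshelve eexists (@ChainMap _ (Complex dd) A k _) => //= n; rewrite kd.
Qed.

(** The differential is induced from that of B. Its targets are not projective,
which is where [proj_exact_factor] and the hypothesis on the terms of N come
in. *)
Lemma cokernel_complex A B (N : int -> C) (k : chain_map A B)
    (e : forall n, mor (B n) (N n)) :
    (forall n, proj_exact (k n) (e n)) -> (forall n, gorenstein_projective (N n)) ->
  exists d dd, exists e' : chain_map B (@Complex C N d dd), forall n, e' n = e n.
Proof.
move=> ke gpN.
have ek n : e n ∘ k n = 0 by case: (ke n) => -[].
have eE n : epi (e n) by case: (ke n).
have /dep_choice[d de] n :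
    exists d : mor (N n) (N (n + 1)), d ∘ e n = e (n + 1) ∘ cdiff B n.
  by apply: (proj_exact_factor (ke n)) => //; rewrite -compmA cmapP compmA ek comp0m.
have dd n : d (n + 1) ∘ d n = 0.
  apply: eE.
  by rewrite -compmA de compmA de -compmA cdiffK compm0 comp0m.
exists d, dd.
by unshelve eexists (@ChainMap _ B (Complex dd) e _) => //= n; rewrite de.
Qed.

Definition levelwise_gp (M : Ch) : Prop :=
  forall i, gorenstein_projective ((M : complex C) i).

Lemma levelwise_gp_right M : levelwise_gp M ->
  exists2 N, levelwise_gp N & @proj_ext Ch M N.
Proof.
move=> gpM.
have /dep_choice[G] n : exists G, gorenstein_projective G /\ proj_ext (M n) G.
  by have [[G gpG MG] _] := gp_biresolving (gpM n); exists G.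
move=> /all_and2[gpG /dep_choice[P /dep_choice[a /dep_choice[p]]]].
move=> /all_and2[projP ap].
(* the shear s makes the second component a d of k equal to s a *)
have /dep_choice[s sa] n : exists s : mor (P n) (P (n + 1)),
    s ∘ a n = a (n + 1) ∘ cdiff M n.
  by case: (ap n) => _ _ /(_ _ (projP (n + 1)))[ext _]; apply: ext.
pose k := to_cone a.
pose e n : mor (cone P n) (S (G n) (P (n + 1))) :=
  bpair S (p n ∘ pr1 S) (pr2 S - s n ∘ pr1 S).
have ke n : proj_exact (k n) (e n) by rewrite /= -sa; apply: proj_exact_padr.
have gpN n : gorenstein_projective (S (G n) (P (n + 1))) by apply: gp_bip.
have [d [dd [e' e'E]]] := cokernel_complex ke gpN.
exists (Complex dd) => //; exists (cone P), k, e'; split; first exact: projective_cone.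
by apply/levelwise_proj_exact => n; rewrite e'E.
Qed.

Lemma levelwise_gp_left M : levelwise_gp M ->
  exists2 K, levelwise_gp K & @proj_ext Ch K M.
Proof.
move=> gpM.
have /dep_choice[G] n : exists G, gorenstein_projective G /\ proj_ext G (M n).
  by have [_ [G gpG MG]] := gp_biresolving (gpM n); exists G.
move=> /all_and2[gpG /dep_choice[P PE]].
(* chain maps out of cone X are families on X^(n+1), so the projective that covers
   M^n has to be placed in X^(n+1) *)
have [X XP] := int_shift (T := fun=> obj C) P.
have {P XP PE}/dep_choice[k /dep_choice[p /all_and2[projX kp]]] n :
    exists (k : mor (G n) (X (n + 1))) (p : mor (X (n + 1)) (M n)),
      projective (X (n + 1)) /\ proj_exact k p.
  by rewrite XP; apply: PE.
have {}projX : forall n, projective (X n) by apply: int_pred.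
have [u [e eE]] := from_cone p.
have /dep_choice[s ps] n : exists s : mor (X n) (X (n + 1)), p n ∘ s = u n.
  by apply: projX; case: (kp n).
pose i n : mor (S (G n) (X n)) (cone X n) :=
  bpair S (pr2 S) (k n ∘ pr1 S - s n ∘ pr2 S).
have ie n : proj_exact (i n) (e n).
  by rewrite eE -ps; apply: proj_exact_padl.
have [d [dd [i' i'E]]] := kernel_complex (fun n => let: And3 K _ _ := ie n in K).
exists (Complex dd); first by move=> n; apply: gp_bip.
exists (cone X), i', e; split; first exact: projective_cone.
by apply/levelwise_proj_exact => n; rewrite i'E; apply: ie.
Qed.

Theorem gp_complexP M :
  @gorenstein_projective Ch M <-> forall i, gorenstein_projective (M i).
Proof.
split; first exact: gp_level.
apply: (@biresolving_gp Ch levelwise_gp) => N gpN.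
by split; [apply: levelwise_gp_right | apply: levelwise_gp_left].
Qed.

End Complexes.

(** * Modules *)

Section ModBiproducts.
Variable R : pzRingType.
Implicit Types U V : lmodType R.

Definition inl_mod U V (x : U) : U * V := (x, 0).
Definition inr_mod U V (y : V) : U * V := (0, y).

Fact inl_mod_linear U V : linear (@inl_mod U V).
Proof.
by move=> c x y; apply/pair_equal_spec; split=> //=; rewrite scaler0 addr0.
Qed.
Fact inr_mod_linear U V : linear (@inr_mod U V).
Proof.
by move=> c x y; apply/pair_equal_spec; split=> //=; rewrite scaler0 addr0.
Qed.

HB.instance Definition _ U V :=
  GRing.isLinear.Build R U (U * V)%type _ (@inl_mod U V) (@inl_mod_linear U V).
HB.instance Definition _ U V :=
  GRing.isLinear.Build R V (U * V)%type _ (@inr_mod U V) (@inr_mod_linear U V).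

Definition mod_biproducts : biproducts (Mod R).
Proof.
apply: (@Biproducts (Mod R) (fun U V => (U * V)%type)
  (fun U V => (@inl_mod U V : {linear _ -> _}) : mod_hom _ _)
  (fun U V => (@inr_mod U V : {linear _ -> _}) : mod_hom _ _)
  (fun U V => (@fst U V : {linear _ -> _}) : mod_hom _ _)
  (fun U V => (@snd U V : {linear _ -> _}) : mod_hom _ _)) => U V;
  apply: mod_hom_eq => // -[x y].
by congr (_, _); [apply: addr0 | apply: add0r].
Defined.

End ModBiproducts.

Theorem corollary3p3 (R : pzRingType) (M : complex (Mod R)) :
  @gorenstein_projective (Ch R) M <->
  forall i : int, @gorenstein_projective (Mod R) (M i).
Proof. exact: gp_complexP (mod_biproducts R) M. Qed.
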